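(* Let $H$ be a non-trivial graph such that some of its adjacency bases are dominating sets of $H$ and some are not. Suppose that there exists an adjacency basis $S'$ for $H$ such that $S'\not\subseteq N_H(v)$ for every $v\in V(H)\setminus S'$, and that for every adjacency basis $S$ for $H$ which is also a dominating set there exists some $v\in V(H)\setminus S$ with $S\subseteq N_H(v)$. Then for every connected graph $G$ of order $n\ge 2$, $$\operatorname{dim}_A(G\odot H)=n\cdot \operatorname{dim}_A(H)+\gamma'(G),$$ where $\gamma'(G)=\min_{v\in V(G)}\gamma(G-v)$.
   Context: All graphs are finite, simple, undirected; non-trivial means order at least 2. A set $S\subseteq V(H)$ is an adjacency generator for $H$ if for every two distinct $x,y\in V(H)\setminus S$ there exists $s\in S$ with $|N_H(s)\cap\{x,y\}|=1$ ($N_H$ the open neighbourhood); an adjacency basis is an adjacency generator of minimum cardinality, and this cardinality is $\operatorname{dim}_A(H)$. A dominating set $D$ of a graph satisfies $\bigcup_{v\in D}N[v]=V$; $\gamma$ denotes the domination number (minimum size of a dominating set). $G-v$ is the graph obtained from $G$ by deleting $v$ and its incident edges. The corona product $G\odot H$ ($G$ of order $n$ with vertices $v_1,\dots,v_n$) consists of $G$ and $n$ disjoint copies $H_1,\dots,H_n$ of $H$, with $v_i$ joined to every vertex of $H_i$. *)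

(* Defs.v *)
From mathcomp Require Import all_boot.
Set Implicit Arguments.
Unset Strict Implicit.
Unset Printing Implicit Defensive.

Record sgraph := SGraph {
  vertex :> finType;
  adj : rel vertex;
  adj_sym : symmetric adj;
  adj_irrefl : irreflexive adj }.
Arguments adj {s} : rename.
Arguments adj_sym : clear implicits.
Arguments adj_irrefl : clear implicits.

Definition nbhd (G : sgraph) (v : G) : {set G} := [set u | adj v u].
Definition cl_nbhd (G : sgraph) (v : G) : {set G} := v |: nbhd v.

Definition connected (G : sgraph) : Prop := forall u v : G, connect adj u v.

Definition adjacency_generator (G : sgraph) (S : {set G}) : bool :=
  [forall x in ~: S, forall y in ~: S,
    (x != y) ==> [exists s in S, #|nbhd s :&: [set x; y]| == 1]].

Lemma adjacency_generatorT (G : sgraph) : adjacency_generator [set: G].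
Proof. by apply/forall_inP => x; rewrite setCT inE. Qed.

(* The full vertex set is the (always valid) seed of the minimum. *)
Definition dimA (G : sgraph) : nat :=
  #|[arg min_(S < [set: G] | adjacency_generator S) #|S| ]|.

Definition adjacency_basis (G : sgraph) (S : {set G}) : bool :=
  adjacency_generator S && (#|S| == dimA G).

Definition dominating (G : sgraph) (D : {set G}) : bool :=
  \bigcup_(v in D) cl_nbhd v == [set: G].

Lemma dominatingT (G : sgraph) : dominating [set: G].
Proof.
by apply/eqP/setP => x; rewrite inE; apply/bigcupP; exists x; rewrite !inE ?eqxx.
Qed.

Definition domination_number (G : sgraph) : nat :=
  #|[arg min_(D < [set: G] | dominating D) #|D| ]|.

Section DeleteVertex.
Variables (G : sgraph) (v : G).

Definition delete_adj : rel {x : G | x != v} := fun x y => adj (val x) (val y).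

Lemma delete_adj_sym : symmetric delete_adj.
Proof. by move=> x y; rewrite /delete_adj adj_sym. Qed.

Lemma delete_adj_irrefl : irreflexive delete_adj.
Proof. by move=> x; rewrite /delete_adj adj_irrefl. Qed.

Definition delete_vertex : sgraph := SGraph delete_adj_sym delete_adj_irrefl.
End DeleteVertex.

(* The default value #|G| exceeds every domination_number (delete_vertex v),
   so it only matters when G has no vertex. *)
Definition gamma' (G : sgraph) : nat :=
  \big[minn/#|G|]_(v : G) domination_number (delete_vertex v).

Section Corona.
Variables G H : sgraph.

(* inl v is the vertex v of G; inr (v, x) is the vertex x of the copy of H
   attached to v. *)
Definition corona_adj : rel (G + G * H) := fun a b =>
  match a, b with
  | inl u, inl v => adj u v
  | inl u, inr (v, _) => u == v
  | inr (u, _), inl v => u == v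
  | inr (u, x), inr (v, y) => (u == v) && adj x y
  end.

Lemma corona_adj_sym : symmetric corona_adj.
Proof.
move=> [u|[u x]] [v|[v y]] /=; last by rewrite eq_sym adj_sym.
- exact: adj_sym.
- exact: eq_sym.
- exact: eq_sym.
Qed.

Lemma corona_adj_irrefl : irreflexive corona_adj.
Proof. by move=> [u|[u x]] /=; rewrite adj_irrefl ?andbF. Qed.

Definition corona : sgraph := SGraph corona_adj_sym corona_adj_irrefl.
End Corona.

(* Main.v *)
(** Write [S] for a set of vertices of the corona, [A] for its trace on [G] and
    [S_i] for its trace on the [i]-th copy of [H]. As the empty set is not an
    adjacency generator of [H], [S] is an adjacency generator exactly when

    - every [S_i] is an adjacency generator of [H];
    - at most one [i] outside [A] has [S_i] not dominating;
    - if [i] is neither in [A] nor dominated by [A], then [S_i] is contained in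
      no [N(x)] with [x] outside [S_i].

    Lower bound: let [D] consist of [A] and of the [i] with [S_i] not a basis.
    If [D] does not dominate [i], then [S_i] is a basis contained in no [N(x)],
    so it is not dominating by hypothesis; hence there is at most one such [i],
    and [D] dominates [G - i].

    Upper bound: take [A] a minimum dominating set of an optimal [G - v], [S_v]
    the basis [S'], and [S_i] a dominating basis for the other [i]. *)
Require Import Defs.
From mathcomp Require Import all_boot.
Set Implicit Arguments.
Unset Strict Implicit.
Unset Printing Implicit Defensive.

(** * Adjacency generators and dominating sets of a single graph *)

Section Graph.
Variable G : sgraph.
Implicit Types (v x y : G) (S D : {set G}).

(** The two singletons are disjoint, so the cardinal is the sum of two adjacency bits, and it is 1
    exactly when the bits differ. *)
Lemma card_nbhd_pair (s x y : G) : x != y ->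
  (#|nbhd s :&: [set x; y]| == 1) = (adj s x != adj s y).
Proof.
move=> xy; rewrite setIUr cardsU -setIIr.
have -> : [set x] :&: [set y] = set0.
  by apply/setP => z; rewrite !inE; case: eqP => // ->; apply: negbTE.
have card1 (z : G) : #|nbhd s :&: [set z]| = adj s z.
  case: (boolP (adj s z)) => sz; last first.
    by rewrite disjoint_setI0 ?cards0 // disjoint_sym disjoints1 inE.
  by rewrite (setIidPr _) ?cards1 // sub1set inE.
by rewrite setI0 cards0 subn0 !card1; case: adj; case: adj.
Qed.

Lemma adjacency_generatorP S :
  reflect (forall x y, x \notin S -> y \notin S -> x != y ->
             exists2 s, s \in S & adj s x != adj s y)
          (adjacency_generator S).
Proof.
apply: (iffP forall_inP) => [gS x y xS yS xy | gS x].
  have /gS/forall_inP/(_ y) : x \in ~: S by rewrite inE.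
  rewrite inE yS xy => /(_ isT)/exists_inP[s sS].
  by rewrite card_nbhd_pair //; exists s.
rewrite inE => xS; apply/forall_inP => y; rewrite inE => yS.
apply/implyP => xy; have [s sS sxy] := gS x y xS yS xy.
by apply/exists_inP; exists s; rewrite ?card_nbhd_pair.
Qed.

Lemma dimA_le S : adjacency_generator S -> dimA G <= #|S|.
Proof.
rewrite /dimA; case: arg_minnP => [|S0 _ min]; first exact: adjacency_generatorT.
exact: min.
Qed.

Lemma dimA_witness : exists2 S : {set G}, adjacency_generator S & #|S| = dimA G.
Proof.
rewrite /dimA; case: arg_minnP => [|S gS _]; first exact: adjacency_generatorT.
by exists S.
Qed.

Lemma adjacency_generator_neq0 S : 2 <= #|G| ->
  adjacency_generator S -> S != set0.
Proof.
move=> /card_gt1P[x [y [_ _ xy]]] /adjacency_generatorP gS.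
by apply/eqP => S0; have [||//|s] := gS x y; rewrite S0 ?inE.
Qed.

Lemma dominatingP D :
  reflect (forall x, x \notin D -> exists2 u, u \in D & adj u x) (dominating D).
Proof.
apply: (iffP eqP) => [DT x xD | dD].
  have : x \in [set: G] by [].
  rewrite -DT => /bigcupP[u uD]; rewrite !inE => /orP[/eqP xu|ux].
    by rewrite xu uD in xD.
  by exists u.
apply/setP => x; rewrite inE; apply/bigcupP.
have [xD|/dD[u uD ux]] := boolP (x \in D).
  by exists x; rewrite // !inE eqxx.
by exists u; rewrite // !inE ux orbT.
Qed.

Lemma dominatingPn D :
  reflect (exists2 x, x \notin D & forall u, u \in D -> ~~ adj u x)
          (~~ dominating D).
Proof.
have -> : dominating D = [forall (x | x \notin D), exists u in D, adj u x].
  apply/dominatingP/forall_inP => dD x /dD; last by move/exists_inP.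
  by move=> ?; apply/exists_inP.
apply: (iffP forall_inPn) => [[x xD /exists_inPn xP]|[x xD xP]]; exists x => //.
exact/exists_inPn.
Qed.

Lemma domination_number_le D : dominating D -> domination_number G <= #|D|.
Proof.
rewrite /domination_number; case: arg_minnP => [|D0 _ min]; first exact: dominatingT.
exact: min.
Qed.

Lemma domination_number_witness :
  exists2 D : {set G}, dominating D & #|D| = domination_number G.
Proof.
rewrite /domination_number; case: arg_minnP => [|D dD _]; first exact: dominatingT.
by exists D.
Qed.

End Graph.

(** * Minima with a seed *)

Lemma bigminn_le_idx (I : Type) (r : seq I) (m : nat) (f : I -> nat) :
  \big[minn/m]_(i <- r) f i <= m.
Proof. by elim/big_rec: _ => // i k _; apply: leq_trans (geq_minr _ _). Qed.

Lemma bigminn_le (I : eqType) (r : seq I) (m : nat) (f : I -> nat) (i : I) :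
  i \in r -> \big[minn/m]_(j <- r) f j <= f i.
Proof.
elim: r => // j r IHr; rewrite inE big_cons => /predU1P[->|/IHr].
  exact: geq_minl.
exact: leq_trans (geq_minr _ _).
Qed.

Lemma bigminn_witness (I : Type) (r : seq I) (m : nat) (f : I -> nat) :
  \big[minn/m]_(i <- r) f i = m \/
  exists i, \big[minn/m]_(i <- r) f i = f i.
Proof.
elim/big_rec: _ => [|i k _ IHk]; first by left.
by rewrite /minn; case: ltnP => _ //; right; exists i.
Qed.

(** * Domination in vertex-deleted graphs *)

Section GammaPrime.
Variable G : sgraph.

(** For [D] avoiding [v], this is domination in [delete_vertex v], phrased without the subtype. *)
Definition dominates_except (v : G) (D : {set G}) : Prop :=
  forall x, x != v -> x \notin D -> exists2 u, u \in D & adj u x.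

Lemma gamma'_le_card : gamma' G <= #|G|.
Proof. exact: bigminn_le_idx. Qed.

Lemma gamma'_le (v : G) (D : {set G}) :
  v \notin D -> dominates_except v D -> gamma' G <= #|D|.
Proof.
move=> vD dD.
apply: leq_trans (bigminn_le _ _ (mem_index_enum v)) _.
pose D' : {set delete_vertex v} := [set x | val x \in D].
have valD' : [set val x | x in D'] \subset D.
  by apply/subsetP => _ /imsetP[x + ->]; rewrite inE.
apply: leq_trans (subset_leq_card valD').
rewrite card_imset; last exact: val_inj.
apply: domination_number_le; apply/dominatingP => x; rewrite inE => xD.
have [u uD ux] := dD _ (valP x) xD.
(* As [v] is outside [D], the dominating vertex survives the deletion. *)
have uv : u != v by apply: contraNneq vD => <-.
by exists (Sub u uv : delete_vertex v); rewrite ?inE.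
Qed.

Lemma gamma'_witness : 0 < #|G| ->
  exists v : G, exists D : {set G},
    [/\ v \notin D, dominates_except v D & #|D| = gamma' G].
Proof.
move=> /card_gt0P[v0 _].
have [v ->] : exists v : G, gamma' G = domination_number (delete_vertex v).
  have [G'|//] := bigminn_witness (index_enum G) #|G|
                    (fun v => domination_number (delete_vertex v)).
  (* If the minimum equals its seed [#|G|], any vertex attains it, since the domination number of
     [delete_vertex v0] is at most [#|G|]. *)
  exists v0; apply/eqP.
  rewrite eqn_leq (bigminn_le _ _ (mem_index_enum v0)) /gamma' G'.
  apply: leq_trans (domination_number_le (dominatingT _)) _.
  by rewrite cardsT card_sig; apply: max_card.
have [D dD <-] := domination_number_witness (delete_vertex v).
exists v, (val @: D); split.
- by apply/imsetP => -[x _ vx]; have := valP x; rewrite -vx eqxx.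
- move=> x xv xD; have [|u uD ux] := dominatingP _ dD (Sub x xv).
    by apply: contra xD => xD; apply/imsetP; exists (Sub x xv).
  by exists (val u); rewrite ?imset_f.
- exact: card_imset val_inj.
Qed.

End GammaPrime.

(** * Adjacency generators of the corona, through their traces *)

Section CoronaGenerator.
Variables G H : sgraph.
Implicit Types (S : {set corona G H}) (A : {set G}) (F : G -> {set H}).

Definition corona_base S : {set G} := [set i | inl i \in S].
Definition corona_fiber S (i : G) : {set H} := [set x | inr (i, x) \in S].

Definition corona_set A F : {set corona G H} :=
  [set a : G + G * H |
    match a with inl i => i \in A | inr (i, x) => x \in F i end].

Lemma corona_base_set A F : corona_base (corona_set A F) = A.
Proof. by apply/setP => i; rewrite !inE. Qed.

Lemma corona_fiber_set A F i : corona_fiber (corona_set A F) i = F i.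
Proof. by apply/setP => x; rewrite !inE. Qed.

Lemma card_corona_set S :
  #|S| = #|corona_base S| + \sum_i #|corona_fiber S i|.
Proof.
rewrite -sum1_card big_mkcond big_sumType /=; congr (_ + _).
  rewrite -sum1_card [RHS]big_mkcond; apply: eq_bigr => i _.
  by rewrite inE.
transitivity (\sum_i \sum_x (if inr (i, x) \in S then 1 else 0)).
  by rewrite pair_bigA; apply: eq_bigr => -[].
apply: eq_bigr => i _; rewrite -sum1_card [RHS]big_mkcond.
by apply: eq_bigr => x _; rewrite inE.
Qed.

(** A vertex outside the [i]-th copy is adjacent to all of that copy or to none of it, so a vertex
    separating two of its points lies in the copy. *)
Lemma corona_generator_fiber S i :
  adjacency_generator S -> adjacency_generator (corona_fiber S i).
Proof.
move=> /adjacency_generatorP gS; apply/adjacency_generatorP => x y.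
rewrite !inE => xS yS xy.
have [|[j|[j z]] sS] := gS _ _ xS yS; first by apply: contraNneq xy => -[->].
  by rewrite /= eqxx.
rewrite /=; case: (j =P i) => [ji|_] //= zxy; exists z => //.
by rewrite inE -ji.
Qed.

(** If both traces failed to dominate, undominated points [x] and [y] of the two copies would have
    no neighbour in [S] at all, hence would not be separated. *)
Lemma corona_generator_dominating S i j :
  adjacency_generator S -> i \notin corona_base S -> j \notin corona_base S ->
  i != j -> dominating (corona_fiber S i) || dominating (corona_fiber S j).
Proof.
move=> /adjacency_generatorP gS; rewrite !inE => iS jS ij.
apply: contraT; rewrite negb_or.
case/andP=> /dominatingPn[x xS xP] /dominatingPn[y yS yP].
have [|||[k|[k z]] kS] := gS (inr (i, x)) (inr (j, y)); rewrite ?inE in xS yS * => //.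
- by apply: contraNneq ij => -[->].
- rewrite /=; case: (k =P i) => [ki|_]; first by rewrite -ki kS in iS.
  by case: (k =P j) => [kj|//]; rewrite -kj kS in jS.
rewrite /=; case: (k =P i) => [ki|_] /=.
  by rewrite ki in kS; rewrite (negbTE (xP z _)) ?inE //= ki (negbTE ij).
by case: (k =P j) => [kj|//] /=; rewrite kj in kS; rewrite (negbTE (yP z _)) ?inE.
Qed.

(** The pair to separate is [x] in the [i]-th copy and [i] itself: only the trace on that copy can
    do it, and all of it is adjacent to [i], so some element must miss [x]. *)
Lemma corona_generator_not_sub S i x :
  adjacency_generator S -> i \notin corona_base S ->
  (forall j, j \in corona_base S -> ~~ adj j i) ->
  x \notin corona_fiber S i -> ~~ (corona_fiber S i \subset nbhd x).
Proof.
move=> /adjacency_generatorP gS iA iP xS; apply/subsetP => sub.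
have [||//|[j|[j z]] jS] := gS (inr (i, x)) (inl i); rewrite ?inE in xS iA * => //.
  rewrite /= (negbTE (iP j _)) ?inE //; case: (j =P i) => [ji|//].
  by rewrite -ji jS in iA.
rewrite /=; case: (j =P i) => [ji|//] /=.
have := sub z; rewrite !inE -ji => /(_ jS).
by rewrite adj_sym => ->.
Qed.

Lemma corona_set_generator A F (v : G) : 2 <= #|H| ->
  (forall i, adjacency_generator (F i)) ->
  (forall i, i != v -> dominating (F i)) ->
  dominates_except v A ->
  (forall x, x \notin F v -> ~~ (F v \subset nbhd x)) ->
  adjacency_generator (corona_set A F).
Proof.
move=> hH gF dF dA Fv.
have F0 i : exists z, z \in F i by apply/set0Pn/adjacency_generator_neq0.
(* The separator is any point of [F i] if [i] and [j] differ; otherwise a neighbour of [i] in [A],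
   or, when [i] is [v], a point of [F v] not adjacent to [y]. *)
have base_fiber i j y : i \notin A -> y \notin F j ->
    exists2 s : corona G H, s \in corona_set A F &
      adj s (inl i) != adj s (inr (j, y)).
  move=> iA yF; have [eq_ij|ij] := eqVneq i j; last first.
    have [z zF] := F0 i; exists (inr (i, z)); rewrite ?inE //=.
    by rewrite eqxx (negbTE ij).
  rewrite -{}eq_ij in yF *.
  have [iv|iv] := eqVneq i v; last first.
    have [k kA ki] := dA i iv iA; exists (inl k); rewrite ?inE //= ki.
    by case: (k =P i) => // eq_ki; rewrite -eq_ki kA in iA.
  rewrite -iv in Fv; have /subsetPn[z zF] := Fv y yF.
  rewrite inE adj_sym => zy; exists (inr (i, z)); rewrite ?inE //=.
  by rewrite eqxx (negbTE zy).
have fiber_fiber i j x y : i != j -> i != v -> x \notin F i ->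
    exists2 s : corona G H, s \in corona_set A F &
      adj s (inr (i, x)) != adj s (inr (j, y)).
  move=> ij iv xF; have [z zF zx] := dominatingP _ (dF i iv) x xF.
  by exists (inr (i, z)); rewrite ?inE //= eqxx zx (negbTE ij).
apply/adjacency_generatorP => -[i|[i x]] [j|[j y]]; rewrite !inE => iS jS ij.
- have [z zF] := F0 i; exists (inr (i, z)); rewrite ?inE //= eqxx.
  by apply: contra ij => /eqP/esym/eqP->.
- exact: base_fiber.
- by have [s sS sP] := base_fiber _ _ _ jS iS; exists s; rewrite // eq_sym.
have [eq_ij|neq_ij] := eqVneq i j.
  rewrite -{}eq_ij in jS ij *; have xy : x != y by apply: contraNneq ij => ->.
  have [s sF sxy] := adjacency_generatorP _ (gF i) x y iS jS xy.
  by exists (inr (i, s)); rewrite ?inE //= eqxx.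
(* Of two distinct copies at least one is not attached to [v], and its dominating trace separates;
   if [i] is [v], the roles are exchanged. *)
have [iv|iv] := eqVneq i v; last exact: fiber_fiber.
have [||s sS sP] := fiber_fiber j i y x _ _ jS; rewrite -?iv 1?eq_sym //.
by exists s; rewrite // eq_sym.
Qed.

End CoronaGenerator.

Theorem theorem12 (H : sgraph) (hH : 2 <= #|H|)
  (hdom : exists S : {set H}, adjacency_basis S /\ dominating S)
  (hndom : exists S : {set H}, adjacency_basis S /\ ~ dominating S)
  (hS' : exists S' : {set H}, adjacency_basis S' /\
     forall v : H, v \notin S' -> ~ (S' \subset nbhd v))
  (hS : forall S : {set H}, adjacency_basis S -> dominating S ->
     exists v : H, v \notin S /\ S \subset nbhd v)
  (G : sgraph) (n : nat) (hn : #|G| = n) (hn2 : 2 <= n) (hG : connected G) :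
  dimA (corona G H) = n * dimA H + gamma' G.
Proof.
apply/eqP; rewrite eqn_leq; apply/andP; split.
  have [|v [A [vA dA cardA]]] := @gamma'_witness G; first by rewrite hn ltnW.
  have [S' [/andP[gS' /eqP cardS'] S'P]] := hS'.
  have [S [/andP[gS /eqP cardS] dS]] := hdom.
  pose F i := if i == v then S' else S.
  have gF : adjacency_generator (corona_set A F).
    apply: (corona_set_generator (v := v)) => //.
    - by move=> i; rewrite /F; case: ifP.
    - by move=> i /negbTE iv; rewrite /F iv.
    - by move=> x; rewrite /F eqxx => /S'P/negP.
  apply: leq_trans (dimA_le gF) _.
  rewrite card_corona_set corona_base_set cardA addnC leq_add2r.
  rewrite (eq_bigr (fun=> dimA H)) => [|i _]; first by rewrite sum_nat_const hn.
  by rewrite corona_fiber_set /F; case: ifP.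
have [S gS <-] := dimA_witness (corona G H).
pose A := corona_base S; pose F := corona_fiber S.
pose B := [set i | dimA H < #|F i|]; pose D := A :|: B.
have gF i : adjacency_generator (F i) := corona_generator_fiber i gS.
have cardS : n * dimA H + #|D| <= #|S|.
  rewrite card_corona_set -/A.
  apply: leq_trans (_ : n * dimA H + (#|A| + #|B|) <= _).
    by rewrite leq_add2l cardsU leq_subr.
  (* Termwise: each trace has at least [dimA H] elements, and one more for indices in [B]. *)
  rewrite addnCA leq_add2l -hn -sum_nat_const -sum1_card [X in _ + X]big_mkcond.
  rewrite -big_split; apply: leq_sum => i _ /=.
  rewrite inE; case: ltnP => [|_]; first by rewrite addn1.
  by rewrite addn0 dimA_le.
apply: leq_trans cardS; rewrite leq_add2l.
have undom i : i \notin D -> (forall j, j \in D -> ~~ adj j i) ->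
    ~~ dominating (F i).
  rewrite !inE negb_or -leqNgt => /andP[iA iB] iD.
  apply/negP => dFi; have bF : adjacency_basis (F i).
    by rewrite /adjacency_basis gF eqn_leq iB dimA_le.
  (* A dominating basis would lie in some [nbhd x], which is excluded at an index that [A] does not
     dominate. *)
  have [x [xF]] := hS _ bF dFi.
  apply/negP/corona_generator_not_sub => //; first by rewrite inE.
  by move=> j jA; rewrite iD // inE jA.
have notA i : i \notin D -> i \notin A by exact: (contra (subsetP (subsetUl A B) i)).
have [dD|/dominatingPn[v vD vP]] := boolP (dominating D).
  (* A deleted vertex must lie outside [D]; when there is none, the seed [#|G|] of [gamma'] gives
     the bound. *)
  have [DT|/subsetPn[v _ vD]] := boolP ([set: G] \subset D).
    by apply: leq_trans (gamma'_le_card G) _; rewrite -cardsT subset_leq_card.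
  by apply: (gamma'_le vD) => x _; apply: dominatingP.
(* A second undominated vertex [x] would yield two non-dominating traces at indices outside [A]. *)
apply: (gamma'_le vD) => x xv xD; apply/exists_inP; apply: contraT.
move=> /exists_inPn xP.
have := corona_generator_dominating gS (notA _ xD) (notA _ vD) xv.
by rewrite (negbTE (undom _ xD xP)) (negbTE (undom _ vD vP)).
Qed.
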